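(* There exist universal constants $c,C>0$ such that for every $q\ge2$ (finite) and every nonzero sequence $\boldsymbol p=(p(j))_{j\ge1}$ with $p(j)\in[0,\frac12]$, $p(j)\ge p(j+1)$ for all $j\ge1$ and $\|\boldsymbol p\|_1<\infty$, $$c\le\liminf_{n\to\infty}\sqrt{\frac{n}{\|\boldsymbol p\|_{q/2}}}\;\mathbb E\|\hat{\boldsymbol p}_n-\boldsymbol p\|_q\le\limsup_{n\to\infty}\sqrt{\frac{n}{\|\boldsymbol p\|_{q/2}}}\;\mathbb E\|\hat{\boldsymbol p}_n-\boldsymbol p\|_q\le C\sqrt q.$$
   Context: $\|x\|_r=(\sum_{j\ge1}|x(j)|^r)^{1/r}$. $\hat{\boldsymbol p}_n=\frac1n\sum_{i=1}^nX_i$ where $X_1,\dots,X_n$ are i.i.d. samples from the product distribution on $\{0,1\}^{\mathbb N}$ whose coordinates are independent Bernoulli variables with parameters $p(j)$. *)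

(* Defs.v *)
From HB Require Import structures.
From mathcomp Require Import all_boot all_order all_algebra finmap.
From mathcomp Require Import all_classical all_reals all_analysis.

Set Implicit Arguments.
Unset Strict Implicit.
Unset Printing Implicit Defensive.

Import Order.TTheory GRing.Theory Num.Theory.

Local Open Scope classical_set_scope.
Local Open Scope ring_scope.

(* Sequences are indexed from 0: [x j] is the (j+1)-st term. *)
Definition lnorm (R : realType) (r : R) (x : nat -> R) : \bar R :=
  ('N[counting]_r%:E[EFin \o x])%E.

Lemma lnormE (R : realType) (r : R) (x : nat -> R) : 0 < r ->
  lnorm r x = ((\sum_(0 <= j <oo) (`|x j| `^ r)%:E) `^ r^-1)%E.
Proof. by move=> r0; rewrite /lnorm Lnorm_counting. Qed.

Definition mutually_independent (d d' : measure_display) (T : measurableType d)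
    (T' : measurableType d') (R : realType) (P : probability T R)
    (I : choiceType) (X : I -> {RV P >-> T'}) : Prop :=
  forall (J : {fset I}) (A : I -> set T'), (forall i, measurable (A i)) ->
    P (\bigcap_(i in [set` J]) X i @^-1` A i) =
    (\prod_(i <- J) P (X i @^-1` A i))%E.

(* {0,1}^N with the product sigma-algebra, generated by the coordinates. *)
Definition cylinders : set (set (nat -> bool)) :=
  [set C | exists j (B : set bool), C = [set x | B (x j)]].

Definition cube : Type := g_sigma_algebraType cylinders.
HB.instance Definition _ := Measurable.on cube.

Definition bit (j : nat) (x : cube) : bool := (x : nat -> bool) j.

Lemma measurable_bit (j : nat) : measurable_fun [set: cube] (bit j).
Proof.
move=> _ B _; rewrite setTI.
by apply: sub_sigma_algebra; exists j, B.
Qed.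

HB.instance Definition _ (j : nat) :=
  isMeasurableFun.Build _ _ cube bool (bit j) (@measurable_bit j).

Definition is_bernoulli_product (R : realType) (p : nat -> R)
    (mu : probability cube R) : Prop :=
  (forall j (B : set bool), mu (bit j @^-1` B) = bernoulli_prob (p j) B) /\
  mutually_independent (fun j => bit j : {RV mu >-> bool}).

Definition iid (d d' : measure_display) (T : measurableType d)
    (T' : measurableType d') (R : realType) (P : probability T R)
    (mu : probability T' R) (X : nat -> {RV P >-> T'}) : Prop :=
  (forall i (A : set T'), measurable A -> distribution P (X i) A = mu A) /\
  mutually_independent X.

Definition empirical_mean (R : realType) (T : Type) (X : nat -> T -> cube)
    (n : nat) (w : T) (j : nat) : R :=
  n%:R^-1 * \sum_(i < n) (bit j (X i w))%:R.

(* The expectation is the integral of an extended-real-valued function: the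
   library's ['E_P] only takes real-valued functions, whereas the norm below
   may be infinite on a null set. *)
Definition expected_lnorm_error (d : measure_display) (T : measurableType d)
    (R : realType) (P : probability T R) (q : R) (p : nat -> R)
    (X : nat -> {RV P >-> cube}) (n : nat) : \bar R :=
  (\int[P]_w lnorm q (fun j => empirical_mean R X n w j - p j)%R)%E.

(* Main.v *)
Require Import Defs.
From HB Require Import structures.
From mathcomp Require Import all_boot all_order all_algebra finmap.
From mathcomp Require Import all_classical all_reals all_analysis.
From mathcomp Require Import measurable_realfun ring lra.

Set Implicit Arguments.
Unset Strict Implicit.
Unset Printing Implicit Defensive.

Import Order.TTheory GRing.Theory Num.Theory.

Local Open Scope classical_set_scope.
Local Open Scope ring_scope.

(* Let S = n (hat p_n(j) - p(j)), a centered binomial variable.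
   Upper bound: a Chernoff-type argument gives
     E|S|^q <= 2 (4 sqrt q)^q (n p(j))^(q/2) + K_q n p(j).
   After summation over j and division by n^(q/2) the second term has order
   n^(1 - q/2): it vanishes as n grows if q > 2, and at q = 2 it is bounded by
   an absolute constant. One concludes by E F^(1/q) <= 2 (E F)^(1/q).
   Lower bound: E|S| >= sqrt(n p(j)) / 16 once n p(j) >= 1, from the second
   and fourth moments; testing the error against the weights p(j)^((q-1)/2) on
   finitely many coordinates carrying half of the sum of p(j)^(q/2) bounds its
   l^q norm from below. *)

(** * Elementary inequalities for exponentials and real powers *)

Section elementary.
Context {R : realType}.

(** As [expR l <= 1 / (1 - l)], it is enough that [(1 + l + 2 l^2) (1 - l) = 1 + l^2 (1 - 2 l)] is
    at least 1. Negative [l] of any size is covered, so both tails can be treated alike. *)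
Lemma expR_le_quad (l : R) : l <= 2^-1 -> expR l <= 1 + l + 2 * l ^+ 2.
Proof.
move=> l2; rewrite -(opprK l) expRN opprK.
have l1 := expR_ge1Dx (- l).
have l0 : 0 < 1 - l by lra.
rewrite invf_ple ?posrE ?expR_gt0//; last by nra.
apply: le_trans l1; rewrite -[leLHS]mul1r ler_pdivrMr; last by nra.
have : 0 <= l ^+ 2 * (1 - 2 * l) by rewrite mulr_ge0 ?sqr_ge0//; lra.
nra.
Qed.

Lemma expR_norm_le (x : R) : expR `|x| <= expR x + expR (- x).
Proof.
have [x0|x0] := leP 0 x.
  by rewrite ger0_norm// lerDl expR_ge0.
by rewrite ltr0_norm// lerDr expR_ge0.
Qed.

(** This is [y <= expR y] at [y = l x / q], raised to the power [q]. *)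
Lemma powR_le_expR (q l x : R) : 0 < q -> 0 < l -> 0 <= x ->
  x `^ q <= (q / l) `^ q * expR (l * x).
Proof.
move=> q0 l0 x0.
have -> : expR (l * x) = expR (l * x / q) `^ q.
  by rewrite -expRM; congr expR; rewrite divfK// gt_eqF.
have ql0 : 0 <= q / l by rewrite divr_ge0// ltW.
rewrite -powRM ?expR_ge0//.
apply: ge0_ler_powR; rewrite ?nnegrE ?(mulr_ge0 _ (expR_ge0 _)) ?(ltW q0)//.
have -> : x = q / l * (l * x / q) by field; rewrite !gt_eqF.
rewrite ler_wpM2l//.
have -> : l * (q / l * (l * x / q)) / q = l * x / q by field; rewrite !gt_eqF.
by apply/ltW/(lt_le_trans _ (expR_ge1Dx _)); rewrite ltrDr.
Qed.

Lemma expR_half_sub2E (x : R) :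
  expR (2^-1 * x) + expR (- 2^-1 * x) - 2 = (expR (x / 4) - (expR (x / 4))^-1) ^+ 2.
Proof.
have -> : expR (2^-1 * x) = expR (x / 4) ^+ 2.
  by rewrite -expRM_natl; congr expR; field.
have -> : expR (- 2^-1 * x) = (expR (x / 4))^-1 ^+ 2.
  by rewrite -expRN -expRM_natl; congr expR; field.
by field; rewrite gt_eqF ?expR_gt0.
Qed.

(** The majorant vanishes to second order at 0, unlike the one of [powR_le_expR]; its binomial mean
    is therefore linear in [n p] when [n p] is small. It equals a multiple of [(a - 1 / a)^2] with
    [a = expR (x / 4)]. *)
Lemma powR_le_cosh (q x : R) : 2 <= q ->
  `|x| `^ q <= 16 * (4 * q) `^ q * (expR (2^-1 * x) + expR (- 2^-1 * x) - 2).
Proof.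
move=> q2.
wlog x0 : x / 0 <= x => [hw|].
  have [|x0] := leP 0 x; first exact: hw.
  have := hw (- x); rewrite oppr_ge0 (ltW x0) normrN => /(_ isT).
  by rewrite mulrN -mulNr mulrNN [X in _ * (X - 2)]addrC.
rewrite ger0_norm// expR_half_sub2E.
set a := expR (x / 4).
have a0 : 0 < a by apply: expR_gt0.
have a1 : 1 + x / 4 <= a by apply: expR_ge1Dx.
have b : a^-1 <= (1 + x / 4)^-1 by rewrite lef_pV2 ?posrE//; lra.
have q41 : 1 <= (4 * q) `^ q.
  by rewrite -[leLHS](powRr0 (4 * q)) ler_powR//; lra.
(* For [x <= 1], [x^q <= x^2] and [a - 1 / a >= x / 4]. For [x > 1], [x^q <= (4 q)^q a], while
   [a >= 5 / 4] makes [(a - 1 / a)^2] at least [9 / 20 * 9 / 25 * a]. *)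
have [x1|x1] := leP x 1.
  have xq : x `^ q <= x ^+ 2.
    have [->|xn0] := eqVneq x 0; first by rewrite powR0 ?expr0n//; lra.
    rewrite -powR_mulrn// ger_powR//.
    by rewrite lt_neqAle eq_sym xn0 x0.
  have ab : x / 4 <= a - a^-1.
    have : (1 + x / 4)^-1 <= 1 by rewrite invf_ple ?posrE ?invr1//; lra.
    lra.
  have : (x / 4) ^+ 2 <= (a - a^-1) ^+ 2.
    by rewrite lerXn2r// ?nnegrE ?(le_trans _ ab)// divr_ge0.
  rewrite expr_div_n => h; apply: (le_trans xq).
  rewrite -mulrA mulrCA; apply: (@le_trans _ _ (16 * (a - a^-1) ^+ 2)).
    have -> : x ^+ 2 = 16 * (x ^+ 2 / 4 ^+ 2) by field.
    by rewrite ler_wpM2l.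
  by rewrite ler_peMl// mulr_ge0 ?sqr_ge0.
have -> : 16 * (4 * q) `^ q * (a - a^-1) ^+ 2 =
  (4 * q) `^ q * (16 * (a - a^-1) ^+ 2) by ring.
have : x `^ q <= (q / 4^-1) `^ q * expR (4^-1 * x).
  by apply: powR_le_expR => //; lra.
rewrite invrK (mulrC q) (mulrC 4^-1) -/a => /le_trans; apply.
rewrite ler_wpM2l ?powR_ge0//.
have aV : a^-1 <= 4 / 5.
  rewrite -[4 / 5]invf_div; apply: le_trans b _.
  by rewrite lef_pV2 ?posrE//; lra.
have aa : 9 / 25 * a <= a - a^-1 by lra.
have : 9 / 20 * (a - a^-1) <= (a - a^-1) ^+ 2.
  by rewrite expr2 ler_wpM2r//; lra.
lra.
Qed.

Lemma expR_half_le2 : expR (2^-1) <= 2 :> R.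
Proof. by apply: le_trans (expR_le_quad _) _ => //; lra. Qed.

Lemma expR_half_powR_le (q : R) : 0 <= q -> expR (q / 2) <= 2 `^ q.
Proof.
move=> q0; rewrite mulrC expRM.
by apply: ge0_ler_powR; rewrite ?nnegrE ?expR_ge0 ?expR_half_le2.
Qed.

Lemma subr1_expR_le (y : R) : expR y - 1 <= y * expR y.
Proof.
have := expR_ge1Dx (- y); rewrite -(ler_pM2r (expR_gt0 y)) -expRD addNr expR0.
lra.
Qed.

Lemma powRV (a x : R) : 0 <= a -> a^-1 `^ x = (a `^ x)^-1.
Proof. by move=> a0; rewrite -powR_inv1// -powRrM mulN1r powRN. Qed.

End elementary.

(** Hölder's inequality up to the factor 2. Each term is at most [b v^q] if [y <= b v], and at most
    [b^(1 - q) y^q] otherwise; the threshold [b = (Y / V)^(1/q)] makes the two sums equal. *)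
Lemma sum_powR_le (R : realType) (N : nat) (q : R) (v y : nat -> R) :
  1 < q -> (forall j, 0 <= v j) -> (forall j, 0 <= y j) ->
  0 < \sum_(j < N) v j `^ q ->
  \sum_(j < N) v j `^ (q - 1) * y j <=
  2 * (\sum_(j < N) v j `^ q) `^ (1 - q^-1) * (\sum_(j < N) y j `^ q) `^ q^-1.
Proof.
move=> q1 v0 y0; set V := \sum_(j < N) v j `^ q; set Y := \sum_(j < N) y j `^ q.
move=> V0.
have q0 : 0 < q by lra.
have Y0 : 0 <= Y by apply: sumr_ge0 => j _; exact: powR_ge0.
have [Yeq0|Yn0] := eqVneq Y 0.
  rewrite big1; first by rewrite mulr_ge0 ?powR_ge0// mulr_ge0 ?powR_ge0.
  move=> j _; have /allP/(_ j) : all (fun j : 'I_N => y j `^ q == 0) (index_enum 'I_N).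
    by rewrite -(@psumr_eq0 _ _ _ xpredT)//; [apply/eqP|move=> i _; exact: powR_ge0].
  rewrite mem_index_enum => /(_ isT)/eqP/powR_eq0_eq0 ->; exact: mulr0.
have {}Y0 : 0 < Y by rewrite lt_neqAle eq_sym Yn0.
set b := (Y / V) `^ q^-1.
have b0 : 0 < b by rewrite powR_gt0// divr_gt0.
have bq : b `^ q = Y / V by rewrite -powRrM mulVf ?gt_eqF// powRr1// ltW// divr_gt0.
apply: (@le_trans _ _ (\sum_(j < N) (b * v j `^ q + b * (V / Y) * y j `^ q))).
  apply: ler_sum => j _.
  have [yb|yb] := leP (y j) (b * v j).
    apply: (@le_trans _ _ (b * v j `^ q)); last first.
      by rewrite lerDl !mulr_ge0 ?powR_ge0// ?invr_ge0 ltW.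
    rewrite -(mulr_powRB1 (v0 j) q0) mulrA (mulrC _ (y j)).
    by rewrite ler_wpM2r ?powR_ge0.
  apply: (@le_trans _ _ (b * (V / Y) * y j `^ q)); last first.
    by rewrite lerDr mulr_ge0 ?powR_ge0// ltW.
  have yj0 : 0 < y j by apply: le_lt_trans yb; rewrite mulr_ge0// ltW.
  have -> : b * (V / Y) * y j `^ q = (y j / b) `^ (q - 1) * y j.
    have b0' := ltW b0.
    rewrite powRM ?invr_ge0// powRV// -(mulr_powRB1 (y0 j) q0).
    have -> : V / Y = (b * b `^ (q - 1))^-1 by rewrite mulr_powRB1// bq invf_div.
    by field; rewrite !gt_eqF// powR_gt0.
  rewrite ler_wpM2r//; apply: ge0_ler_powR; rewrite ?nnegrE; first by lra.
  - exact: v0.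
  - by rewrite divr_ge0// ltW.
  - by rewrite ler_pdivlMr// mulrC ltW.
rewrite big_split/= -!mulr_sumr -/V -/Y /b powRM ?invr_ge0 ?(ltW Y0) ?(ltW V0)//.
rewrite powRV ?(ltW V0)// powRB ?powRr1 ?(ltW V0)//; last first.
  by rewrite [V == 0]gt_eqF// implybT.
move: (Y `^ q^-1) (V `^ q^-1) (powR_gt0 q^-1 V0) => s t t0.
rewrite le_eqVlt; apply/orP; left; apply/eqP.
by field; rewrite !gt_eqF.
Qed.

(** * Centered binomial means, by iterating the transition operator of the walk whose increments are
    Bernoulli minus their mean *)

Definition walk_step (R : realType) (p : R) (f : R -> R) (x : R) : R :=
  p * f (x + (1 - p)) + (1 - p) * f (x - p).

(* [binomial_mean p n f] is E f(B - np) for B binomial of parameters n, p. *)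
Fixpoint binomial_mean (R : realType) (p : R) (n : nat) (f : R -> R) : R :=
  if n is m.+1 then binomial_mean p m (walk_step p f) else f 0.

Section binomial_mean.
Context {R : realType}.
Variable p : R.
Hypothesis p01 : 0 <= p <= 1.
Implicit Types (f g : R -> R) (n : nat).

Local Notation E := (binomial_mean p).

Lemma ler_binomial_mean n f g : (forall x, f x <= g x) -> E n f <= E n g.
Proof.
move: p01 => /andP[p0 p1].
elim: n f g => [|n IHn] f g fg /=; first exact: fg.
by apply: IHn => x; rewrite lerD// ler_wpM2l ?subr_ge0.
Qed.

Lemma binomial_mean_lin n a b f g :
  E n (fun x => a * f x + b * g x) = a * E n f + b * E n g.
Proof.
elim: n f g => [//|n IHn] f g /=; rewrite -IHn; congr E.
by apply/funext => x; rewrite /walk_step; ring.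
Qed.

Lemma binomial_meanZ n a f : E n (fun x => a * f x) = a * E n f.
Proof.
have := binomial_mean_lin n a 0 f f; rewrite mul0r addr0 => <-.
by congr E; apply/funext => x; rewrite mul0r addr0.
Qed.

Lemma binomial_meanD n f g : E n (fun x => f x + g x) = E n f + E n g.
Proof.
have := binomial_mean_lin n 1 1 f g; rewrite !mul1r => <-.
by congr E; apply/funext => x; rewrite !mul1r.
Qed.

Lemma binomial_mean_cst n a : E n (fun=> a) = a.
Proof.
elim: n a => [//|n IHn] a /=; rewrite -[RHS](IHn a); congr E.
by apply/funext => x; rewrite /walk_step; ring.
Qed.

Lemma binomial_mean_ge0 n f : (forall x, 0 <= f x) -> 0 <= E n f.
Proof. by move=> f0; rewrite -[leLHS](binomial_mean_cst n 0) ler_binomial_mean. Qed.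

Lemma binomial_mean1 n : E n id = 0.
Proof.
elim: n => [//|n IHn] /=; rewrite -[RHS]IHn; congr E.
by apply/funext => x; rewrite /walk_step /=; ring.
Qed.

Lemma binomial_mean2 n : E n (fun x => x ^+ 2) = n%:R * (p * (1 - p)).
Proof.
elim: n => [|n IHn] /=; first by rewrite expr0n mul0r.
have -> : walk_step p (fun x => x ^+ 2) = fun x => x ^+ 2 + p * (1 - p).
  by apply/funext => x; rewrite /walk_step; ring.
by rewrite binomial_meanD binomial_mean_cst IHn -natr1; ring.
Qed.

Lemma binomial_mean4 n : E n (fun x => x ^+ 4) =
  n%:R * (p * (1 - p) * (1 - 3 * (p * (1 - p)))) +
  3 * n%:R * (n%:R - 1) * (p * (1 - p)) ^+ 2.
Proof.
elim: n => [|n IHn] /=; first by rewrite expr0n /=; ring.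
(* The terms with factors 6, 4 and 1 carry the second, third and fourth moments of one increment;
   the cubic term disappears because increments have mean 0. *)
have -> : walk_step p (fun x => x ^+ 4) = fun x => x ^+ 4 +
    (6 * (p * (1 - p)) * x ^+ 2 + (4 * (p * (1 - p)) * (1 - 2 * p) * x +
    p * (1 - p) * (1 - 3 * (p * (1 - p))))).
  by apply/funext => x; rewrite /walk_step; ring.
rewrite !binomial_meanD !binomial_meanZ binomial_mean_cst IHn.
by rewrite binomial_mean2 binomial_mean1 -natr1; ring.
Qed.

Lemma binomial_mean_expR n l : E n (fun x => expR (l * x)) =
  (p * expR (l * (1 - p)) + (1 - p) * expR (- (l * p))) ^+ n.
Proof.
elim: n => [|n IHn] /=; first by rewrite mulr0 expR0.
rewrite exprS -IHn -binomial_meanZ; congr E.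
apply/funext => x; rewrite /walk_step.
have -> : l * (x + (1 - p)) = l * x + l * (1 - p) by ring.
have -> : l * (x - p) = l * x + - (l * p) by ring.
by rewrite !expRD; ring.
Qed.

(** Each factor is [expR (- l p) (1 + p (expR l - 1))]; [1 + y <= expR y] and [expR_le_quad] then
    cancel the linear term in [l]. The exponent keeps the factor [p], so that deviations scale with
    [sqrt (n p)] rather than [sqrt n]. *)
Lemma binomial_mean_expR_le n l : l <= 2^-1 ->
  E n (fun x => expR (l * x)) <= expR (2 * n%:R * p * l ^+ 2).
Proof.
move=> l2; move: p01 => /andP[p0 p1]; rewrite binomial_mean_expR.
have -> : 2 * n%:R * p * l ^+ 2 = n%:R * (2 * p * l ^+ 2) by ring.
rewrite expRM_natl lerXn2r ?nnegrE ?expR_ge0//.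
  by rewrite addr_ge0// mulr_ge0 ?expR_ge0// subr_ge0.
have -> : expR (l * (1 - p)) = expR (- (l * p)) * expR l.
  by rewrite -expRD; congr expR; ring.
have -> : expR (2 * p * l ^+ 2) =
    expR (- (l * p)) * expR (p * (l + 2 * l ^+ 2)).
  by rewrite -expRD; congr expR; ring.
have -> : p * (expR (- (l * p)) * expR l) + (1 - p) * expR (- (l * p)) =
    expR (- (l * p)) * (1 + p * (expR l - 1)) by ring.
rewrite ler_wpM2l ?expR_ge0//; apply: le_trans (expR_ge1Dx _).
by rewrite lerD2l ler_wpM2l//; have := expR_le_quad l2; lra.
Qed.

End binomial_mean.

(** * Absolute moments of the centered binomial law *)

Section moments.
Context {R : realType}.
Variable p : R.
Hypothesis p01 : 0 <= p <= 1.
Local Notation E := (binomial_mean p).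

(** Gaussian regime: the moment is compared with the two exponential moments at [l] and [- l]. *)
Lemma binomial_moment_large (q : R) n : 2 <= q -> q <= n%:R * p ->
  E n (fun x => `|x| `^ q) <=
  2 * (4 * Num.sqrt q) `^ q * (n%:R * p) `^ (q / 2).
Proof.
move=> q2; set v := n%:R * p => qv.
have q0 : 0 < q by lra.
have v0 : 0 < v by lra.
(* With this choice [2 v l^2 = q / 2], so each exponential moment is at most [expR (q / 2) <= 2^q],
   and [q / l = 2 sqrt (q v)]. The assumption [q <= v] gives [l <= 1 / 2]. *)
pose l := Num.sqrt (q / v) / 2.
have qv1 : q / v <= 1 by rewrite ler_pdivrMr// mul1r.
have l0 : 0 < l by rewrite divr_gt0// sqrtr_gt0 divr_gt0.
have l12 : l <= 2^-1.
  by rewrite ler_pdivrMr// mulVf// -[leRHS]sqrtr1 ler_sqrt.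
have l2 : l ^+ 2 = q / v / 4.
  by rewrite expr_div_n sqr_sqrtr ?(divr_ge0 (ltW q0) (ltW v0))//; field; rewrite gt_eqF.
have qlE : q / l = 2 * Num.sqrt q * Num.sqrt v.
  have h1 : 0 <= q / l by rewrite (divr_ge0 (ltW q0) (ltW l0)).
  have h2 : 0 <= 2 * Num.sqrt q * Num.sqrt v by rewrite !mulr_ge0 ?sqrtr_ge0.
  apply/eqP; rewrite -(@eqrXn2 _ 2)//.
  rewrite expr_div_n l2 !exprMn (sqr_sqrtr (ltW q0)) (sqr_sqrtr (ltW v0)); apply/eqP; field.
  by rewrite !gt_eqF.
have vE : v `^ (q / 2) = Num.sqrt v `^ q.
  by rewrite mulrC powRrM powR12_sqrt// ltW.
apply: (@le_trans _ _ (E n (fun x => (q / l) `^ q *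
    (expR (l * x) + expR (- l * x))))).
  apply: ler_binomial_mean => // x.
  apply: (le_trans (powR_le_expR q0 l0 (normr_ge0 x))).
  rewrite ler_wpM2l ?powR_ge0// mulNr.
  by rewrite -[in leLHS](gtr0_norm l0) -normrM expR_norm_le.
rewrite binomial_meanZ binomial_meanD.
have e1 : E n (fun x => expR (l * x)) <= 2 `^ q.
  apply: (le_trans (binomial_mean_expR_le p01 n l12)).
  apply: le_trans (expR_half_powR_le (ltW q0)).
  have -> : 2 * n%:R * p = 2 * v by rewrite /v; ring.
  rewrite l2 ler_expR le_eqVlt; apply/orP; left; apply/eqP; field.
  by rewrite gt_eqF.
have e2 : E n (fun x => expR (- l * x)) <= 2 `^ q.
  have lN : - l <= 2^-1 by lra.
  apply: (le_trans (binomial_mean_expR_le p01 n lN)).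
  apply: le_trans (expR_half_powR_le (ltW q0)).
  have -> : 2 * n%:R * p = 2 * v by rewrite /v; ring.
  rewrite sqrrN l2 ler_expR le_eqVlt; apply/orP; left; apply/eqP; field.
  by rewrite gt_eqF.
apply: (@le_trans _ _ ((q / l) `^ q * (2 * 2 `^ q))).
  by rewrite ler_wpM2l ?powR_ge0//; lra.
rewrite vE qlE mulrCA -[leRHS]mulrA -!powRM ?mulr_ge0 ?sqrtr_ge0// ler_wpM2l//.
by rewrite le_eqVlt; apply/orP; left; apply/eqP; congr (_ `^ _); ring.
Qed.

(** Poisson regime: by [powR_le_cosh] at rate [1 / 2], the mean is controlled by [2 (expR (v / 2) -
    1) <= v expR (v / 2) <= v 2^q]. Linearity in [v] makes the bound summable over the
    coordinates. *)
Lemma binomial_moment_small (q : R) n : 2 <= q -> n%:R * p <= q ->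
  E n (fun x => `|x| `^ q) <= 16 * (8 * q) `^ q * (n%:R * p).
Proof.
move=> q2; set v := n%:R * p => vq.
have v0 : 0 <= v by rewrite mulr_ge0//; case/andP: p01.
apply: (@le_trans _ _ (E n (fun x => 16 * (4 * q) `^ q *
    ((expR (2^-1 * x) + expR (- 2^-1 * x)) + -2)))).
  by apply: ler_binomial_mean => // x; exact: powR_le_cosh.
rewrite binomial_meanZ !binomial_meanD binomial_mean_cst.
have -> : (8 * q) `^ q = (4 * q) `^ q * 2 `^ q.
  by rewrite -powRM//; [congr (_ `^ _); ring|lra].
rewrite -!mulrA 2?ler_wpM2l ?powR_ge0//.
have e1 := @binomial_mean_expR_le _ _ p01 n 2^-1 (lexx _).
have e2 := @binomial_mean_expR_le _ _ p01 n (- 2^-1) (ltac:(lra)).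
rewrite sqrrN in e2.
have vE : 2 * n%:R * p * 2^-1 ^+ 2 = v / 2 by rewrite /v; field.
rewrite vE in e1 e2.
have e3 := subr1_expR_le (v / 2).
have e4 : v * expR (v / 2) <= v * 2 `^ q.
  rewrite ler_wpM2l//; apply: le_trans (expR_half_powR_le _); last by lra.
  by rewrite ler_expR; lra.
lra.
Qed.

Lemma binomial_moment_le (q : R) n : 2 <= q ->
  E n (fun x => `|x| `^ q) <=
  2 * (4 * Num.sqrt q) `^ q * (n%:R * p) `^ (q / 2) +
  16 * (8 * q) `^ q * (n%:R * p).
Proof.
move=> q2; have v0 : 0 <= n%:R * p by rewrite mulr_ge0//; case/andP: p01.
have [qv|vq] := leP q (n%:R * p).
  apply: (le_trans (binomial_moment_large q2 qv)).
  by rewrite lerDl mulr_ge0// mulr_ge0 ?powR_ge0.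
apply: (le_trans (binomial_moment_small q2 (ltW vq))).
by rewrite lerDr mulr_ge0 ?powR_ge0// mulr_ge0 ?powR_ge0.
Qed.

(* From [|x| >= x^2 / a - x^4 / a^3] with [a = 4 sqrt (np)]. *)
Lemma binomial_mean_norm_ge n : p <= 2^-1 -> 1 <= n%:R * p ->
  Num.sqrt (n%:R * p) / 16 <= E n (fun x => `|x|).
Proof.
have /andP[p0 p1] := p01; move=> p2; set v := n%:R * p => v1.
set s := Num.sqrt v.
have s2 : s ^+ 2 = v by rewrite sqr_sqrtr; lra.
have s1 : 1 <= s by rewrite -sqrtr1 ler_sqrt; lra.
have s0 : s != 0 by rewrite gt_eqF//; lra.
pose a := 4 * s.
apply: (@le_trans _ _ (E n (fun x => a^-1 * x ^+ 2 + - (a ^- 3) * x ^+ 4))).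
  rewrite binomial_mean_lin binomial_mean2 binomial_mean4.
  have e2 : v / 2 <= n%:R * (p * (1 - p)).
    have -> : n%:R * (p * (1 - p)) = v * (1 - p) by rewrite /v; ring.
    by rewrite ler_wpM2l//; lra.
  have pp0 : 0 <= p * (1 - p) by rewrite mulr_ge0//; lra.
  (* The fourth moment is at most [v + 3 v^2], and [v <= v^2] because [v >= 1]. *)
  have e4 : n%:R * (p * (1 - p) * (1 - 3 * (p * (1 - p)))) +
      3 * n%:R * (n%:R - 1) * (p * (1 - p)) ^+ 2 <= 4 * v ^+ 2.
    have h1 : n%:R * (p * (1 - p)) <= v.
      rewrite /v ler_wpM2l// ler_piMr//; lra.
    have h2 : (n%:R * (p * (1 - p))) ^+ 2 <= v ^+ 2.
      by rewrite lerXn2r ?nnegrE ?mulr_ge0//; lra.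
    have h3 : 0 <= n%:R * (p * (1 - p)) ^+ 2 by rewrite mulr_ge0 ?sqr_ge0.
    have h4 : v <= v ^+ 2 by rewrite expr2 ler_peMr//; lra.
    rewrite exprMn in h2; nra.
  (* With [a = 4 s] and [v = s^2] this is [s / 8 - s / 16]. *)
  apply: (@le_trans _ _ (a^-1 * (v / 2) + - a ^- 3 * (4 * v ^+ 2))).
    rewrite -s2 /a le_eqVlt; apply/orP; left; apply/eqP; field.
    by rewrite s0.
  rewrite lerD//.
    by rewrite ler_wpM2l// invr_ge0 /a; lra.
  by rewrite !mulNr lerN2 ler_wpM2l// invr_ge0 exprn_ge0// /a; lra.
apply: ler_binomial_mean => // x.
have a0 : 0 < a by rewrite /a; lra.
have -> : x ^+ 2 = `|x| ^+ 2 by rewrite real_normK// num_real.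
have -> : x ^+ 4 = `|x| ^+ 4.
  have e (z : R) : z ^+ 4 = (z ^+ 2) ^+ 2 by ring.
  by rewrite !e real_normK// num_real.
set y := `|x| / a.
have y0 : 0 <= y by rewrite divr_ge0// ltW.
have -> : `|x| = a * y by rewrite /y mulrCA divff ?mulr1// gt_eqF.
have -> : a^-1 * (a * y) ^+ 2 + - a ^- 3 * (a * y) ^+ 4 =
  a * (y ^+ 2 - y ^+ 4) by field; rewrite gt_eqF.
rewrite ler_pM2l//.
have [y1|y1] := leP y 1.
  have : 0 <= y ^+ 4 by rewrite exprn_ge0.
  have : y ^+ 2 <= y by rewrite expr2 ler_piMl.
  lra.
have : y ^+ 2 <= y ^+ 4 by rewrite ler_eXn2l.
lra.
Qed.

End moments.

(** * The sum of one centered coordinate over the samples has the binomial law *)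

Section sampling.
Context {R : realType} {d : measure_display} {T : measurableType d}.
Variables (P : probability T R) (mu : probability cube R).
Variables (p : nat -> R) (X : nat -> {RV P >-> cube}).
Hypothesis p01 : forall j, 0 <= p j <= 1.
Hypothesis mup : is_bernoulli_product p mu.
Hypothesis iidX : iid mu X.
Variable j : nat.

Definition bit_prob (r : R) (b : bool) : R := if b then r else 1 - r.

Definition centered_sum (n : nat) (w : T) : R :=
  \sum_(i < n) ((bit j (X i w))%:R - p j).

Definition pattern (n m : nat) (s : nat -> bool) : set T :=
  [set w | forall i, (n <= i < m)%N -> bit j (X i w) = s i].

Lemma measurable_bitX i (B : set bool) : measurable ((bit j \o X i) @^-1` B).
Proof.
by rewrite -[X in measurable X]setTI; apply: measurableT_comp.
Qed.

Lemma patternE n m s : pattern n m s =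
  \bigcap_(i in [set` seq_fset tt (index_iota n m)])
    X i @^-1` (bit j @^-1` [set s i]).
Proof.
apply/seteqP; split=> w h i hi; apply: h.
  by rewrite -mem_index_iota -(seq_fsetE tt).
by rewrite /mkset seq_fsetE mem_index_iota.
Qed.

Lemma measurable_pattern n m s : measurable (pattern n m s).
Proof.
rewrite patternE; apply: fin_bigcap_measurable; first exact: finite_fset.
by move=> i _; exact: measurable_bitX.
Qed.

Lemma probability_pattern n m s :
  P (pattern n m s) = (\prod_(n <= i < m) bit_prob (p j) (s i))%:E.
Proof.
rewrite patternE; case: iidX => dX indX; rewrite indX; last first.
  move=> i; rewrite -[X in measurable X]setTI; exact: measurable_bit.
rewrite (perm_big _ (seq_fset_perm tt _)) undup_id ?iota_uniq//= -prodEFin.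
apply: eq_bigr => i _.
have := dX i (bit j @^-1` [set s i]); rewrite /distribution /pushforward /= => ->.
  case: mup => -> _; rewrite bernoulli_probE// !diracE /bit_prob.
  case: (s i).
    by rewrite (@mem_set _ [set true]) ?memNset//= mule1 mule0 adde0.
  by rewrite (@mem_set _ [set false] false) ?memNset//= mule1 mule0 add0e.
by rewrite -[X in measurable X]setTI; exact: measurable_bit.
Qed.

Lemma measurable_centered_sum n : measurable_fun [set: T] (centered_sum n).
Proof.
apply: measurable_sum => i; apply: measurable_funB => //.
rewrite (_ : (fun w => _) = (fun b : bool => b%:R : R) \o (bit j \o X i)) //.
by apply: measurableT_comp.
Qed.

(** The induction lowers [n]: sample [n] leaves the sum and enters the prescribed pattern. The sum
    uses samples below [n] and the pattern those from [n] on; at [n = 0] only the probability of a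
    pattern remains, and this is where independence enters. *)
Lemma integral_pattern n m s (f : R -> R) : (n <= m)%N ->
  measurable_fun setT f -> (forall x, 0 <= f x) ->
  (\int[P]_w (f (centered_sum n w) * \1_(pattern n m s) w)%:E =
  (binomial_mean (p j) n f * \prod_(n <= i < m) bit_prob (p j) (s i))%:E)%E.
Proof.
elim: n s f => [|n IHn] s f nm mf f0 /=.
  under eq_integral do rewrite /centered_sum big_ord0 EFinM.
  rewrite ge0_integralZl//.
  - rewrite integral_indic//; last exact: measurable_pattern.
    by rewrite setIT EFinM -probability_pattern.
  - by apply/measurable_EFinP; apply: measurable_indic; exact: measurable_pattern.
  - by rewrite lee_fin f0.
pose s' b i := if i == n then b else s i.
have mg (b : bool) : measurable_fun setT (fun x : R => f (x + (b%:R - p j))).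
  by apply: measurableT_comp => //; apply: measurable_funD.
(* Split according to the value of the bit of sample [n]: at each [w] one of the two indicators is 0
   and the other equals that of the original pattern. *)
transitivity (\int[P]_w
  ((f (centered_sum n w + (true%:R - p j)) * \1_(pattern n m (s' true)) w)%:E +
   (f (centered_sum n w + (false%:R - p j)) * \1_(pattern n m (s' false)) w)%:E))%E.
  apply: eq_integral => w _; rewrite -EFinD; congr EFin.
  rewrite /centered_sum big_ord_recr/= -/(centered_sum n w).
  have pE b : bit j (X n w) = b ->
      \1_(pattern n m (s' b)) w = \1_(pattern n.+1 m s) w :> R.
    move=> bE; rewrite !indicE; congr (_%:R); congr nat_of_bool.
    apply/idP/idP => /set_mem h; apply/mem_set => i /andP[ni im].
      by rewrite h ?im ?(ltnW ni)// /s' gtn_eqF.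
    rewrite /s'; case: eqVneq => [->//|inn].
    by apply: h; rewrite im andbT ltn_neqAle eq_sym inn.
  have pNE b : bit j (X n w) <> b -> \1_(pattern n m (s' b)) w = 0 :> R.
    move=> bE; rewrite indicE memNset// => /(_ n); rewrite leqnn nm => /(_ isT).
    by rewrite /s' eqxx.
  case bE : (bit j (X n w)) => /=.
    by rewrite (pE true bE) (pNE false) ?mulr0 ?addr0// bE.
  by rewrite (pE false bE) (pNE true) ?mulr0 ?add0r// bE.
have m1 (b : bool) : measurable_fun [set: T] (fun w =>
    (f (centered_sum n w + (b%:R - p j)) * \1_(pattern n m (s' b)) w)%:E).
  apply/measurable_EFinP; apply: measurable_funM.
    by apply: (measurableT_comp (mg b)); exact: measurable_centered_sum.
  by apply: measurable_indic; exact: measurable_pattern.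
rewrite ge0_integralD//; last 2 first.
- by move=> w _; rewrite lee_fin mulr_ge0// f0.
- by move=> w _; rewrite lee_fin mulr_ge0// f0.
rewrite (IHn (s' true) (fun x => f (x + (true%:R - p j)))) ?(ltnW nm)//.
rewrite (IHn (s' false) (fun x => f (x + (false%:R - p j)))) ?(ltnW nm)//.
have prodE b : \prod_(n <= i < m) bit_prob (p j) (s' b i) =
    bit_prob (p j) b * \prod_(n.+1 <= i < m) bit_prob (p j) (s i).
  rewrite big_ltn// {1}/s' eqxx; congr *%R; apply: eq_big_nat => i /andP[ni _].
  by rewrite /s' gtn_eqF.
rewrite !prodE -EFinD; congr EFin.
rewrite (_ : walk_step (p j) f = fun x =>
  p j * f (x + (true%:R - p j)) + (1 - p j) * f (x + (false%:R - p j))).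
  by rewrite binomial_mean_lin /=; ring.
by apply/funext => x; rewrite /walk_step sub0r.
Qed.

Lemma integral_centered_sum n (f : R -> R) :
  measurable_fun setT f -> (forall x, 0 <= f x) ->
  (\int[P]_w (f (centered_sum n w))%:E = (binomial_mean (p j) n f)%:E)%E.
Proof.
(* For [m = n] the pattern constrains no sample, so its indicator is constantly 1. *)
move=> mf f0; have := integral_pattern (fun=> true) (leqnn n) mf f0.
rewrite big_geq// mulr1 => <-; apply: eq_integral => w _.
rewrite indicE mem_set ?mulr1// => i /andP[ni].
by rewrite ltnNge ni.
Qed.

End sampling.

(** * Moving the power [1/q] outside the expectation *)

Section lyapunov.
Context {R : realType} {d : measure_display} {T : measurableType d}.
Variable P : probability T R.

(** A substitute for Jensen's inequality, at the price of a factor 2: integrate the pointwise bound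
    [(F / B)^(1/q) <= 1 + F / B]. The value [+oo] is allowed for [F], as needed for the series
    inside the norm. *)
Lemma integral_poweR_inv_le (F : T -> \bar R) (q B : R) : 1 <= q -> 0 < B ->
  measurable_fun setT F -> (forall w, 0 <= F w)%E ->
  (\int[P]_w F w <= B%:E)%E ->
  (\int[P]_w (F w `^ q^-1) <= (2 * B `^ q^-1)%:E)%E.
Proof.
move=> q1 B0 mF F0 FB.
have q0 : 0 < q by lra.
apply: (@le_trans _ _ (\int[P]_w ((B `^ q^-1)%:E * (1 + B^-1%:E * F w)))%E).
  apply: ge0_le_integral => //.
  - by move=> w _; exact: poweR_ge0.
  - exact: (measurableT_comp (measurable_poweR q^-1) mF).
  - apply: emeasurable_funM => //; apply: emeasurable_funD => //.
    exact: emeasurable_funM.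
  - move=> w _; have := F0 w; case: (F w) => [r| |]//; rewrite ?lee_fin => r0.
    +
      have -> : r = B * (B^-1 * r) by rewrite mulrA divff ?mul1r ?gt_eqF.
      set s := B^-1 * r; have s0 : 0 <= s by rewrite mulr_ge0// invr_ge0 ltW.
      rewrite powRM ?(ltW B0)// ler_wpM2l ?powR_ge0//.
      have -> : B^-1 * (B * s) = s by rewrite mulrA mulVf ?mul1r ?gt_eqF.
      have [s1|s1] := leP s 1.
        apply: (@le_trans _ _ 1); last by rewrite lerDl.
        have <- : (1 : R) `^ q^-1 = 1 by rewrite powR1.
        by apply: ge0_ler_powR; rewrite ?nnegrE// invr_ge0 ltW.
      apply: (@le_trans _ _ s); last by rewrite lerDr.
      by apply: ler1_powR; [exact: ltW|rewrite invf_le1].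
    + by rewrite gt0_muley ?lte_fin ?invr_gt0// addey// gt0_muley ?lte_fin ?powR_gt0// leey.
rewrite ge0_integralZl//; last 3 first.
- by apply: emeasurable_funD => //; exact: emeasurable_funM.
- by move=> w _; rewrite adde_ge0// mule_ge0// lee_fin invr_ge0 ltW.
- by rewrite lee_fin powR_ge0.
rewrite ge0_integralD//; last 2 first.
- by move=> w _; rewrite mule_ge0// lee_fin invr_ge0 ltW.
- exact: emeasurable_funM.
rewrite ge0_integralZl//; last by rewrite lee_fin invr_ge0 ltW.
have -> : (\int[P]_w 1 = 1)%E.
  by rewrite integral_cst// mul1e; exact: probability_setT.
rewrite mulrC EFinM lee_wpmul2l ?lee_fin ?powR_ge0//.
rewrite -[2]/(1 + 1) EFinD leeD2l//.
apply: (@le_trans _ _ (B^-1%:E * B%:E)%E).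
  by rewrite lee_wpmul2l// lee_fin invr_ge0 ltW.
by rewrite -EFinM mulVf// gt_eqF.
Qed.

End lyapunov.

(** * Bounds on the expected error at a fixed sample size *)

Section expected_error.
Context {R : realType} {d : measure_display} {T : measurableType d}.
Variables (P : probability T R) (mu : probability cube R).
Variables (p : nat -> R) (X : nat -> {RV P >-> cube}).
Hypothesis p01 : forall j, 0 <= p j <= 1.
Hypothesis mup : is_bernoulli_product p mu.
Hypothesis iidX : iid mu X.
Variable q : R.
Hypothesis q2 : 2 <= q.

Local Notation err n w j := (empirical_mean R X n w j - p j).

Lemma empirical_errorE n j w : (0 < n)%N ->
  err n w j = n%:R^-1 * centered_sum p X j n w.
Proof.
move=> n0; rewrite /empirical_mean /centered_sum sumrB mulrBr; congr (_ - _).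
rewrite sumr_const card_ord -[p j *+ n]mulr_natl mulrA mulVf ?mul1r//.
by rewrite pnatr_eq0 -lt0n.
Qed.

Lemma measurable_error n j : (0 < n)%N ->
  measurable_fun [set: T] (fun w => err n w j).
Proof.
move=> n0; under eq_fun do rewrite empirical_errorE//.
by apply: measurable_funM => //; exact: measurable_centered_sum.
Qed.

Lemma measurable_error_powR n j : (0 < n)%N ->
  measurable_fun [set: T] (fun w => (`|err n w j| `^ q)%:E).
Proof.
move=> n0; apply/measurable_EFinP.
apply: (measurableT_comp (@measurable_powR R q)).
by apply: measurableT_comp => //; exact: measurable_error.
Qed.

Lemma integral_error_powR n j : (0 < n)%N ->
  (\int[P]_w (`|err n w j| `^ q)%:E =
   (n%:R^-1 `^ q * binomial_mean (p j) n (fun x => `|x| `^ q))%:E)%E.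
Proof.
move=> n0; rewrite -binomial_meanZ -(integral_centered_sum p01 mup iidX); last 2 first.
- apply: measurable_funM => //.
  apply: (measurableT_comp (@measurable_powR R q)); exact: normr_measurable.
- by move=> x; rewrite mulr_ge0 ?powR_ge0.
apply: eq_integral => w _; rewrite empirical_errorE// normrM powRM//.
by rewrite ger0_norm ?invr_ge0.
Qed.

Lemma integral_error_norm n j : (0 < n)%N ->
  (\int[P]_w (`|err n w j|)%:E =
   (n%:R^-1 * binomial_mean (p j) n (fun x => `|x|))%:E)%E.
Proof.
move=> n0; rewrite -binomial_meanZ -(integral_centered_sum p01 mup iidX); last 2 first.
- by apply: measurable_funM => //; exact: normr_measurable.
- by move=> x; rewrite mulr_ge0.
apply: eq_integral => w _; rewrite empirical_errorE// normrM.
by rewrite ger0_norm ?invr_ge0.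
Qed.

(** The series of [q]-th powers is integrated term by term, and each term is bounded by
    [binomial_moment_le], whose two summands produce [V] and [L]. *)
Lemma expected_lnorm_error_le n (V L : R) : (0 < n)%N -> 0 < V -> 0 <= L ->
  (\sum_(0 <= j <oo) (p j `^ (q / 2))%:E = V%:E)%E ->
  (\sum_(0 <= j <oo) (p j)%:E = L%:E)%E ->
  (expected_lnorm_error q p X n <=
   (2 * (n%:R^-1 `^ q * (2 * (4 * Num.sqrt q) `^ q * (n%:R `^ (q / 2) * V) +
     16 * (8 * q) `^ q * (n%:R * L))) `^ q^-1)%:E)%E.
Proof.
move=> n0 V0 L0 pV pL.
have q1 : 1 < q by apply: lt_le_trans q2; lra.
have q0 : 0 < q by lra.
rewrite /expected_lnorm_error.
under eq_integral do rewrite lnormE//.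
apply: integral_poweR_inv_le => //.
- exact: ltW.
- rewrite mulr_gt0 ?powR_gt0 ?invr_gt0 ?ltr0n//.
  apply: ltr_wpDr; first by rewrite !mulr_ge0 ?powR_ge0.
  by rewrite !mulr_gt0 ?powR_gt0 ?mulr_gt0 ?sqrtr_gt0 ?ltr0n.
- apply: ge0_emeasurable_sum => // j _; exact: measurable_error_powR.
- by move=> w; apply: nneseries_ge0 => j _ _; rewrite lee_fin powR_ge0.
rewrite integral_nneseries//; last first.
- by move=> j; exact: measurable_error_powR.
under eq_eseriesr do rewrite integral_error_powR//.
set a := n%:R^-1 `^ q; set A := 2 * _; set K := 16 * _.
have a0 : 0 <= a by exact: powR_ge0.
have A0 : 0 <= A by rewrite /A mulr_ge0// powR_ge0.
have K0 : 0 <= K by rewrite /K mulr_ge0// powR_ge0.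
have p0 j : 0 <= p j by case/andP: (p01 j).
apply: (@le_trans _ _ (\sum_(0 <= j <oo)
   ((a * A * n%:R `^ (q / 2))%:E * (p j `^ (q / 2))%:E +
    (a * K * n%:R)%:E * (p j)%:E))%E).
  apply: lee_nneseries => j _.
    rewrite lee_fin mulr_ge0 ?powR_ge0//.
    by apply: (binomial_mean_ge0 (p01 j)) => x; exact: powR_ge0.
  rewrite -!EFinM -EFinD lee_fin.
  rewrite -!mulrA -mulrDr ler_wpM2l//.
  apply: (le_trans (binomial_moment_le (p01 j) n q2)).
  by rewrite powRM// -!mulrA.
rewrite nneseriesD; last 2 first.
- by move=> j _ _; rewrite -EFinM lee_fin !mulr_ge0 ?powR_ge0.
- by move=> j _ _; rewrite -EFinM lee_fin !mulr_ge0 ?powR_ge0.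
rewrite (@nneseriesZl _ (fun j => (p j `^ (q / 2))%:E)); last first.
  by move=> j _; rewrite lee_fin powR_ge0.
rewrite (@nneseriesZl _ (fun j => (p j)%:E)); last by move=> j _; rewrite lee_fin.
rewrite pV pL.
rewrite -!EFinM -EFinD lee_fin le_eqVlt; apply/orP; left; apply/eqP; ring.
Qed.

(** The weights [v j ^ (q - 1)], with [v j = sqrt (p j)], form the functional that norms the vector
    [v] in [l^q]. As the mean of [|err j|] is at least [v j / (16 sqrt n)], the weighted mean is at
    least [V / (16 sqrt n)]. *)
Lemma expected_lnorm_error_ge n N : (0 < n)%N -> (forall j, p j <= 2^-1) ->
  (forall j, (j < N)%N -> 0 < p j -> 1 <= n%:R * p j) ->
  0 < \sum_(j < N) p j `^ (q / 2) ->
  (((32 * Num.sqrt n%:R)^-1 * (\sum_(j < N) p j `^ (q / 2)) `^ q^-1)%:E <=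
   expected_lnorm_error q p X n)%E.
Proof.
move=> n0 ph np; set V := \sum_(j < N) _ => V0.
have q1 : 1 < q by apply: lt_le_trans q2; lra.
have q0 : 0 < q by lra.
have p0 j : 0 <= p j by case/andP: (p01 j).
pose v j := Num.sqrt (p j).
have v0 j : 0 <= v j by exact: sqrtr_ge0.
have vE j : v j `^ q = p j `^ (q / 2).
  by rewrite /v -powR12_sqrt// -powRrM mulrC.
have VE : V = \sum_(j < N) v j `^ q by apply: eq_bigr => j _; rewrite vE.
(* The inverse of the factor in [sum_powR_le]; its 2 turns 16 into 32. *)
pose c := (2 * V `^ (1 - q^-1))^-1.
have c0 : 0 <= c by rewrite invr_ge0 mulr_ge0 ?powR_ge0.
have n0' : 0 < n%:R :> R by rewrite ltr0n.
apply: (@le_trans _ _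
    (\int[P]_w (c%:E * \sum_(j < N) ((v j `^ (q - 1))%:E * (`|err n w j|)%:E)))%E).
  have mE (j : 'I_N) : measurable_fun [set: T]
      (fun w => ((v j `^ (q - 1))%:E * (`|err n w j|)%:E)%E).
    under eq_fun do rewrite -EFinM.
    apply/measurable_EFinP; apply: measurable_funM => //.
    by apply: measurableT_comp => //; exact: measurable_error.
  rewrite ge0_integralZl//; last 2 first.
  - exact: emeasurable_sum.
  - by move=> w _; apply: sume_ge0 => j _; rewrite -EFinM lee_fin mulr_ge0 ?powR_ge0.
  rewrite ge0_integral_sum//; last first.
  - by move=> j w _; rewrite -EFinM lee_fin mulr_ge0 ?powR_ge0.
  apply: (@le_trans _ _ (c%:E * \sum_(j < N) ((Num.sqrt n%:R)^-1 / 16 * v j `^ q)%:E)%E).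
    rewrite sumEFin -EFinM lee_fin -mulr_sumr -VE /c powRB ?powRr1 ?(ltW V0)//; last first.
      by rewrite [V == 0]gt_eqF// implybT.
    rewrite le_eqVlt; apply/orP; left; apply/eqP; field.
    by rewrite !gt_eqF ?powR_gt0 ?sqrtr_gt0.
  rewrite lee_wpmul2l ?lee_fin//; apply: lee_sum => j _.
  rewrite ge0_integralZl//; last 2 first.
  - by apply/measurable_EFinP; apply: measurableT_comp => //; exact: measurable_error.
  - by rewrite lee_fin powR_ge0.
  rewrite integral_error_norm// -EFinM lee_fin.
  rewrite -(mulr_powRB1 (v0 j) q0) mulrA mulrC ler_wpM2l ?powR_ge0//.
  apply: (@le_trans _ _ (n%:R^-1 * (Num.sqrt (n%:R * p j) / 16))).
    rewrite sqrtrM// -/(v j) -[n%:R^-1](sqr_sqrtr) ?invr_ge0// sqrtrV//.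
    rewrite le_eqVlt; apply/orP; left; apply/eqP; field.
    by rewrite gt_eqF ?sqrtr_gt0.
  rewrite ler_wpM2l ?invr_ge0//.
  (* If [p j = 0] the required lower bound is 0. *)
  have [pj0|pj0] := ltP 0 (p j).
    by apply: (binomial_mean_norm_ge (p01 j)) => //; exact: np.
  have -> : p j = 0 by apply/eqP; rewrite eq_le pj0 p0.
  by rewrite mulr0 sqrtr0 mul0r binomial_mean_ge0// lexx ler01.
apply: ge0_le_integral => //.
- move=> w _; apply: mule_ge0 => //; apply: sume_ge0 => j _.
  by rewrite -EFinM lee_fin mulr_ge0 ?powR_ge0.
- apply: emeasurable_funM => //; apply: emeasurable_sum => j.
  under eq_fun do rewrite -EFinM.
  apply/measurable_EFinP; apply: measurable_funM => //.
  by apply: measurableT_comp => //; exact: measurable_error.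
- under eq_fun do rewrite lnormE//.
  apply: (measurableT_comp (measurable_poweR q^-1)).
  by apply: ge0_emeasurable_sum => // j _; exact: measurable_error_powR.
move=> w _; rewrite lnormE//.
apply: (@le_trans _ _ ((\sum_(j < N) `|err n w j| `^ q) `^ q^-1)%:E).
  under eq_bigr do rewrite -EFinM.
  rewrite sumEFin -EFinM lee_fin /c ler_pdivrMl ?mulr_gt0 ?powR_gt0//.
  by rewrite VE; apply: (@sum_powR_le R N q v (fun j => `|err n w j|)) => //;
    rewrite -VE.
rewrite -poweR_EFin; apply: gt0_ler_poweR.
- by rewrite invr_ge0 ltW.
- by rewrite in_itv/= leey andbT lee_fin sumr_ge0// => j _; exact: powR_ge0.
- rewrite in_itv/= leey andbT; apply: nneseries_ge0 => j _ _.
  by rewrite lee_fin powR_ge0.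
rewrite -sumEFin -(big_mkord xpredT (fun j => (`|err n w j| `^ q)%:E)).
by apply: nneseries_lim_ge => j _ _; rewrite lee_fin powR_ge0.
Qed.

End expected_error.

(** * Passage to the limit in the sample size *)

Lemma limn_einf_ge_near (R : realType) (u : (\bar R)^nat) (c : \bar R) (n0 : nat) :
  (forall n, (n0 <= n)%N -> (c <= u n)%E) -> (c <= limn_einf u)%E.
Proof.
move=> cu; rewrite limn_einf_lim (cvg_lim _ (@cvg_einfs_sup _ u))//.
apply: (@le_trans _ _ (einfs u n0)); last by apply: ereal_sup_ubound; exists n0.
by apply: le_ereal_inf_tmp => _ [n /= n0n <-]; exact: cu.
Qed.

Lemma limn_esup_le_near (R : realType) (u : (\bar R)^nat) (c : \bar R) (n0 : nat) :
  (forall n, (n0 <= n)%N -> (u n <= c)%E) -> (limn_esup u <= c)%E.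
Proof.
move=> uc; rewrite -[limn_esup u]oppeK -limn_einfN leeNl.
by apply: (@limn_einf_ge_near _ _ _ n0) => n n0n /=; rewrite leeN2 uc.
Qed.

Lemma nneseries_half (R : realType) (a : nat -> R) (V : R) :
  (forall j, 0 <= a j) -> (\sum_(0 <= j <oo) (a j)%:E = V%:E)%E -> 0 < V ->
  exists N, V / 2 <= \sum_(j < N) a j.
Proof.
move=> a0 aV V0; apply: contrapT => /forallNP h.
have : (V%:E <= (V / 2)%:E)%E; last by rewrite lee_fin; lra.
rewrite -aV; apply: lime_le.
  by apply: is_cvg_nneseries => j _ _; rewrite lee_fin.
apply: nearW => N; rewrite big_mkord sumEFin lee_fin ltW// ltNge.
exact/negP/h.
Qed.

Lemma eventually_ge1 (R : realType) (p : nat -> R) (N : nat) :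
  exists n0, forall n, (n0 <= n)%N ->
  forall j, (j < N)%N -> 0 < p j -> 1 <= n%:R * p j.
Proof.
(* Indices with [p j = 0] are harmless: the inverse of 0 is 0, and they contribute 1 to the
   maximum. *)
exists (\max_(j < N) (Num.trunc (p j)^-1).+1) => n nN j jN pj0.
rewrite -ler_pdivrMr// div1r; apply: (le_trans (ltW (truncnS_gt _))).
by rewrite ler_nat (leq_trans _ nN)// (leq_bigmax (Ordinal jN)).
Qed.

Lemma eventually_powR_ge (R : realType) (r M : R) : 0 < r ->
  exists n0, forall n, (n0 <= n)%N -> M <= n%:R `^ r.
Proof.
move=> r0; have [M0|M0] := leP M 0.
  by exists 0%N => n _; rewrite (le_trans M0)// powR_ge0.
exists (Num.trunc (M `^ r^-1)).+1 => n hn.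
have -> : M = (M `^ r^-1) `^ r by rewrite -powRrM mulVf ?gt_eqF// powRr1// ltW.
apply: ge0_ler_powR; rewrite ?nnegrE ?powR_ge0//; first exact: ltW.
by rewrite (le_trans (ltW (truncnS_gt _)))// ler_nat.
Qed.

(** The [q/2]-norm of [p] is [V^(2/q)], so the normalizing factor is itself a power [1/q], namely of
    [n^(q/2) / V]. *)
Lemma normalizer_error (R : realType) (q V B : R) (n : nat) : 2 <= q ->
  (0 < n)%N -> 0 < V -> 0 <= B ->
  Num.sqrt (n%:R / V `^ (q / 2)^-1) * B `^ q^-1 = (n%:R `^ (q / 2) / V * B) `^ q^-1.
Proof.
move=> q2 n0 V0 B0.
have q0 : 0 < q by lra.
have nV0 : 0 <= n%:R `^ (q / 2) / V by rewrite divr_ge0 ?powR_ge0// ltW.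
rewrite powRM//; congr *%R.
rewrite powRM ?powR_ge0 ?invr_ge0 ?(ltW V0)//.
rewrite -powR12_sqrt ?divr_ge0 ?powR_ge0//.
rewrite powRM ?invr_ge0 ?powR_ge0// -powRrM; congr (_ `^ _ * _).
  by field; rewrite gt_eqF.
rewrite !powRV ?powR_ge0 ?(ltW V0)// -powRrM; congr (_ `^ _)^-1.
by field; rewrite gt_eqF.
Qed.

(* At [q = 2] the second summand does not decay, and there
   [16 * (8 * q) `^ q = 64 `^ q]; this is the origin of the factor 64 below. *)
Lemma eventually_bound (R : realType) (q V L : R) : 2 <= q -> 0 < V -> 0 <= L ->
  (q = 2 -> L = V) -> exists n0, forall n, (n0 <= n)%N ->
  (n%:R `^ (q / 2) / V * (n%:R^-1 `^ q * (2 * (4 * Num.sqrt q) `^ q *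
     (n%:R `^ (q / 2) * V) + 16 * (8 * q) `^ q * (n%:R * L)))) `^ q^-1
  <= 192 * Num.sqrt q.
Proof.
move=> q2 V0 L0 LV.
have q0 : 0 < q by lra.
have s1 : 1 <= Num.sqrt q by rewrite -sqrtr1 ler_sqrt; lra.
pose K := 16 * (8 * q) `^ q.
have K0 : 0 <= K by rewrite mulr_ge0// powR_ge0.
have [n0 hn0] : exists n0, forall n, (n0 <= n)%N -> (0 < n)%N ->
    K * L / V <= 64 `^ q * n%:R `^ (q / 2 - 1).
  have [q2'|q2'] := eqVneq q 2.
    exists 0%N => n _ _; rewrite LV// q2' mulfK ?gt_eqF//.
    rewrite divff ?gt_eqF// subrr powRr0 mulr1 /K q2' !powR_mulrn//; lra.
  (* For [q > 2] the exponent [q / 2 - 1] is positive, so a large [n] suffices. *)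
  have [|n0 hn] := @eventually_powR_ge R (q / 2 - 1) (K * L / V / 64 `^ q).
    have : 2 < q by rewrite lt_neqAle eq_sym q2' q2.
    lra.
  by exists n0 => n /hn; rewrite ler_pdivrMr ?powR_gt0// [n%:R `^ _ * _]mulrC.
exists (maxn n0 1) => n; rewrite geq_max => /andP[nn0 n1].
have n0' : 0 < n%:R :> R by rewrite ltr0n.
have {hn0}h := hn0 n nn0 n1.
apply: (@le_trans _ _ (((192 * Num.sqrt q) `^ q) `^ q^-1)); last first.
  by rewrite -powRrM mulfV ?gt_eqF// powRr1 ?lexx// mulr_ge0// sqrtr_ge0.
apply: ge0_ler_powR; rewrite ?nnegrE ?powR_ge0//.
- by rewrite invr_ge0 ltW.
- rewrite !mulr_ge0 ?invr_ge0 ?powR_ge0 ?(ltW V0)//.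
  by rewrite addr_ge0// !mulr_ge0 ?powR_ge0// ltW.
rewrite -/K; set A := 2 * _.
set x := n%:R `^ (q / 2).
have x0 : 0 < x by rewrite powR_gt0.
have nqE : n%:R^-1 `^ q = (x * x)^-1.
  rewrite powRV// /x -powRD; last by rewrite (gt_eqF n0') implybT.
  by congr (_ `^ _)^-1; field.
have h1 : n%:R `^ (q / 2 - 1) = x / n%:R.
  by rewrite powRB ?powRr1// (gt_eqF n0') implybT.
rewrite h1 in h.
(* Since [n^(-q) = x^(-2)], the main term loses all dependence on [n] and [V]. *)
have -> : x / V * (n%:R^-1 `^ q * (A * (x * V) + K * (n%:R * L))) =
    A + K * L / V * (n%:R / x).
  by rewrite nqE; field; rewrite !gt_eqF.
have h2 : K * L / V * (n%:R / x) <= 64 `^ q.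
  apply: (@le_trans _ _ (64 `^ q * (x / n%:R) * (n%:R / x))).
    by rewrite ler_wpM2r// divr_ge0// ltW.
  by rewrite le_eqVlt; apply/orP; left; apply/eqP; field; rewrite !gt_eqF.
have sq0 := sqrtr_ge0 q.
have h3 : (4 * Num.sqrt q) `^ q <= (64 * Num.sqrt q) `^ q.
  by apply: ge0_ler_powR; rewrite ?nnegrE ?mulr_ge0// ?ler_wpM2r//; [lra|rewrite ler_nat].
have h4 : 64 `^ q <= (64 * Num.sqrt q) `^ q.
  by apply: ge0_ler_powR; rewrite ?nnegrE ?mulr_ge0//; lra.
(* The total is at most [3 (64 sqrt q)^q], and the factor 3 is absorbed by tripling the base. *)
have -> : 192 * Num.sqrt q = 3 * (64 * Num.sqrt q) by ring.
apply: (@le_trans _ _ (3 * (64 * Num.sqrt q) `^ q)).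
  by rewrite /A; lra.
by apply: le1r_powRZ; rewrite ?mulr_ge0//; lra.
Qed.

(** As [p j <= 1] and [q / 2 >= 1], the second series is dominated by the first. The equality at
    [q = 2] is kept for the boundary case of [eventually_bound]. *)
Lemma series_powR_le (R : realType) (p : nat -> R) (q : R) :
  2 <= q -> p <> (fun=> 0) -> (forall j, 0 <= p j <= 2^-1) ->
  (lnorm 1 p < +oo)%E ->
  exists L V, [/\ 0 < V, 0 <= L, q = 2 -> L = V,
    (\sum_(0 <= j <oo) (p j)%:E = L%:E)%E &
    (\sum_(0 <= j <oo) (p j `^ (q / 2))%:E = V%:E)%E].
Proof.
move=> q2 pn0 p01.
have p0 j : 0 <= p j by case/andP: (p01 j).
have p1 j : p j <= 1 by case/andP: (p01 j) => _ h; apply: le_trans h _; lra.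
rewrite lnormE//.
under eq_eseriesr do rewrite powRr1// ger0_norm//.
rewrite invr1 poweRe1; last by apply: nneseries_ge0 => j _ _; rewrite lee_fin.
move=> Lfin.
have L0 : (0 <= \sum_(0 <= j <oo) (p j)%:E)%E.
  by apply: nneseries_ge0 => j _ _; rewrite lee_fin.
have VL : (\sum_(0 <= j <oo) (p j `^ (q / 2))%:E <= \sum_(0 <= j <oo) (p j)%:E)%E.
  apply: lee_nneseries => j _; first by rewrite lee_fin powR_ge0.
  rewrite lee_fin; have [->|pj0] := eqVneq (p j) 0.
    by rewrite powR0// gt_eqF//; lra.
  by apply: ge1r_powR; [rewrite p1 lt_neqAle eq_sym pj0 p0|lra].
have V0 : (0 < \sum_(0 <= j <oo) (p j `^ (q / 2))%:E)%E.
  have [j pj] : exists j, p j != 0.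
    apply: contrapT => /forallNP h; apply: pn0; apply/funext => j.
    by apply/eqP/negP => /negP; exact: h.
  apply: (@lt_le_trans _ _ (\sum_(0 <= i < j.+1) (p i `^ (q / 2))%:E)%E); last first.
    by apply: nneseries_lim_ge => i _ _; rewrite lee_fin powR_ge0.
  apply: (@lt_le_trans _ _ (p j `^ (q / 2))%:E).
    by rewrite lte_fin powR_gt0// lt_neqAle eq_sym pj p0.
  by rewrite big_nat_recr//= leeDr// sume_ge0// => i _; rewrite lee_fin powR_ge0.
exists (fine (\sum_(0 <= j <oo) (p j)%:E)%E).
exists (fine (\sum_(0 <= j <oo) (p j `^ (q / 2))%:E)%E).
have Lf : (\sum_(0 <= j <oo) (p j)%:E)%E \is a fin_num by rewrite ge0_fin_numE.
have Vf : (\sum_(0 <= j <oo) (p j `^ (q / 2))%:E)%E \is a fin_num.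
  by rewrite ge0_fin_numE; [exact: le_lt_trans Lfin|exact: ltW].
split; rewrite ?fineK//.
- by rewrite -lte_fin fineK.
- by rewrite -lee_fin fineK.
- move=> ->; congr fine; apply: eq_eseriesr => j _.
  by rewrite divff ?powRr1.
Qed.

Theorem proposition8 (R : realType) :
  exists c C : R, 0 < c /\ 0 < C /\
  forall (q : R) (p : nat -> R),
    2 <= q ->
    p <> (fun=> 0) ->
    (forall j, 0 <= p j <= 2^-1) ->
    (forall j, p j.+1 <= p j) ->
    (lnorm 1 p < +oo)%E ->
  forall (d : measure_display) (T : measurableType d) (P : probability T R)
    (mu : probability cube R) (X : nat -> {RV P >-> cube}),
    is_bernoulli_product p mu ->
    iid mu X ->
  let u (n : nat) : \bar R :=
    (sqrte (n%:R%:E / lnorm (q / 2) p) * expected_lnorm_error q p X n)%E in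
  [/\ (c%:E <= limn_einf u)%E,
      (limn_einf u <= limn_esup u)%E &
      (limn_esup u <= (C * Num.sqrt q)%:E)%E].
Proof.
(* [384 = 2 * 192], with the 2 from [integral_poweR_inv_le]; [64 = 32 * 2], with the 2 from keeping
   only half of the series. *)
exists 64^-1, 384; split; first by rewrite invr_gt0.
split=> [|q p q2 pn0 ph _ lp d T P mu X mup iidX u]; first by rewrite ltr0n.
have [L [V [V0 L0 LV pL pV]]] := series_powR_le q2 pn0 ph lp.
have p01 j : 0 <= p j <= 1.
  by have /andP[-> h] := ph j; apply: le_trans h _; lra.
have p0 j : 0 <= p j by case/andP: (p01 j).
have p12 j : p j <= 2^-1 by case/andP: (ph j).
have uE n : (0 < n)%N -> u n =
    ((Num.sqrt (n%:R / V `^ (q / 2)^-1))%:E * expected_lnorm_error q p X n)%E.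
  move=> n0; rewrite /u lnormE; last by lra.
  under eq_eseriesr do rewrite ger0_norm//.
  by rewrite pV poweR_EFin inver gt_eqF ?powR_gt0// -EFinM.
split; last 2 first.
- exact: limn_einf_sup.
- have [n0 hn0] := eventually_bound q2 V0 L0 LV.
  (* The maximum with 1 discards [n = 0], where [n%:R^-1] takes its default value 0. *)
  apply: (@limn_esup_le_near _ _ _ (maxn n0 1)) => n; rewrite geq_max => /andP[nn0 n1].
  have B0 : 0 <= n%:R^-1 `^ q * (2 * (4 * Num.sqrt q) `^ q *
      (n%:R `^ (q / 2) * V) + 16 * (8 * q) `^ q * (n%:R * L)).
    by rewrite mulr_ge0 ?powR_ge0// addr_ge0// !mulr_ge0 ?powR_ge0// ltW.
  rewrite uE//; apply: (@le_trans _ _ ((Num.sqrt (n%:R / V `^ (q / 2)^-1))%:E *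
      (2 * (n%:R^-1 `^ q * (2 * (4 * Num.sqrt q) `^ q *
      (n%:R `^ (q / 2) * V) + 16 * (8 * q) `^ q * (n%:R * L))) `^ q^-1)%:E)%E).
    rewrite lee_wpmul2l ?lee_fin ?sqrtr_ge0//.
    exact: (expected_lnorm_error_le p01 mup iidX q2).
  rewrite -EFinM lee_fin mulrCA normalizer_error//.
  by have := hn0 n nn0; lra.
have [N VN] : exists N, V / 2 <= \sum_(j < N) p j `^ (q / 2).
  by apply: nneseries_half pV V0 => j; exact: powR_ge0.
have [n0 hn0] := eventually_ge1 p N.
apply: (@limn_einf_ge_near _ _ _ (maxn n0 1)) => n; rewrite geq_max => /andP[nn0 n1].
have n0' : 0 < n%:R :> R by rewrite ltr0n.
have W0 : 0 < \sum_(j < N) p j `^ (q / 2) by apply: lt_le_trans VN; rewrite divr_gt0.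
rewrite uE//.
apply: le_trans (lee_wpmul2l _ (expected_lnorm_error_ge p01 mup iidX q2 n1 p12
  (hn0 n nn0) W0)); last by rewrite lee_fin sqrtr_ge0.
rewrite -EFinM lee_fin.
set W := \sum_(j < N) _ in VN W0 *.
(* The factors [sqrt n] cancel and only the ratio [W / V] remains. It is at least [1 / 2], and its
   power [1/q] stays at least [1 / 2] because [1/q <= 1]. *)
have -> : Num.sqrt (n%:R / V `^ (q / 2)^-1) *
    ((32 * Num.sqrt n%:R)^-1 * W `^ q^-1) = 32^-1 * (W / V) `^ q^-1.
  have q0 : 0 < q by lra.
  rewrite powRM ?invr_ge0 ?(ltW V0) ?(ltW W0)// powRV ?(ltW V0)//.
  have -> : V `^ q^-1 = Num.sqrt (V `^ (q / 2)^-1).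
    rewrite -powR12_sqrt ?powR_ge0// -powRrM; congr (_ `^ _).
    by field; rewrite gt_eqF.
  rewrite sqrtrM// sqrtrV ?powR_ge0//; field.
  by rewrite !gt_eqF ?sqrtr_gt0 ?powR_gt0.
have -> : 64^-1 = 32^-1 * 2^-1 :> R by field.
rewrite ler_wpM2l// ?invr_ge0//.
apply: (@le_trans _ _ (2^-1 `^ q^-1)).
  by apply: ger1_powR; [lra|rewrite invf_le1; lra].
apply: ge0_ler_powR; rewrite ?nnegrE ?invr_ge0//.
- lra.
- by rewrite divr_ge0// ltW.
- by rewrite ler_pdivlMr// mulrC.
Qed.
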